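(* Let $f$ be convex on $\mathcal{X}=\mathcal{X}_1\times\cdots\times\mathcal{X}_{N_b}$, let $\alpha=B/N_b$, and let the step sizes be defined recursively by $$\gamma_0=1,\qquad \gamma_{t+1}=\frac{\sqrt{\alpha^2\gamma_t^4+4\gamma_t^2}-\alpha\gamma_t^2}{2},\quad t\ge 0 .$$ Then the iterates $\{\mathbf{x}^t\}$ of the randomized block Frank-Wolfe algorithm with step sizes $\{\gamma_t\}$ satisfy, for all $t\ge 1$, $$\mathbb{E}\left[h(\mathbf{x}^t)\right]\le \frac{4(1-\alpha)h(\mathbf{x}^0)}{(\alpha t+2-\alpha)^2}+\frac{2t\,\bar C_f^{B}}{(\alpha t+2-\alpha)^2}$$ and $$g_t\le \frac{27(\alpha t+1)}{2\alpha^3t^3}\left[(t+1)\bar C_f^{B}+2(1-\alpha)h(\mathbf{x}^0)\right],$$ where $g_t:=\min_{k\in\{0,1,\ldots,t\}}\mathbb{E}[g(\mathbf{x}^k)]$.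
   Context: Setting. $N_b\ge 1$ is an integer, $\mathcal{N}_b=\{1,\ldots,N_b\}$, $B\in\{1,\ldots,N_b\}$, $\alpha:=B/N_b$. Vectors $\mathbf{x}\in\mathbb{R}^d$ are split into blocks $\mathbf{x}=(\mathbf{x}_1,\ldots,\mathbf{x}_{N_b})$. The feasible set is $\mathcal{X}=\mathcal{X}_1\times\cdots\times\mathcal{X}_{N_b}$, with each $\mathcal{X}_n$ nonempty, convex and compact. The objective $f$ is real-valued and differentiable on (an open set containing) $\mathcal{X}$; $\nabla_{\mathbf{x}_n}f$ denotes the partial gradient with respect to block $n$. The problem is to minimize $f$ over $\mathcal{X}$; $\mathbf{x}^*$ is a global minimizer of $f$ over $\mathcal{X}$, and $h(\mathbf{x}):=f(\mathbf{x})-f(\mathbf{x}^* )$. The duality gap is $g(\mathbf{x}):=\sup_{\mathbf{s}\in\mathcal{X}}(\mathbf{x}-\mathbf{s})^\top\nabla f(\mathbf{x})$ for $\mathbf{x}\in\mathcal{X}$. Randomized block Frank-Wolfe algorithm. Start from a (deterministic) $\mathbf{x}^0\in\mathcal{X}$. At iteration $t=0,1,\ldots$: draw $\mathcal{B}_t$ uniformly at random among all subsets of $\mathcal{N}_b$ with exactly $B$ elements, independently of previous draws; for each $n\in\mathcal{B}_t$ pick a minimizer $\mathbf{s}_n^t\in\arg\min_{\mathbf{s}_n\in\mathcal{X}_n}\langle \mathbf{s}_n,\nabla_{\mathbf{x}_n}f(\mathbf{x}^t)\rangle$ (ties broken arbitrarily, as a function of the draws $\mathcal{B}_0,\ldots,\mathcal{B}_t$);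 set $\mathbf{x}_n^{t+1}=(1-\gamma_t)\mathbf{x}_n^t+\gamma_t\mathbf{s}_n^t$ for $n\in\mathcal{B}_t$ and $\mathbf{x}_n^{t+1}=\mathbf{x}_n^t$ for $n\notin\mathcal{B}_t$. Expectations are over the random draws. Curvature. For $\mathcal{B}\subseteq\mathcal{N}_b$, $$C_f^{\mathcal{B}}:=\sup \frac{2}{\gamma^2}\Big(f(\mathbf{y})-f(\mathbf{x})-\sum_{n\in\mathcal{B}}\langle\mathbf{y}_n-\mathbf{x}_n,\nabla_{\mathbf{x}_n}f(\mathbf{x})\rangle\Big),$$ the supremum being over $\gamma\in(0,1]$, $\mathbf{x}\in\mathcal{X}$, $\mathbf{s}_n\in\mathcal{X}_n$ ($n\in\mathcal{B}$), where $\mathbf{y}_n=(1-\gamma)\mathbf{x}_n+\gamma\mathbf{s}_n$ for $n\in\mathcal{B}$ and $\mathbf{y}_n=\mathbf{x}_n$ otherwise. The expected set curvature is $\bar C_f^{B}:=\binom{N_b}{B}^{-1}\sum_{\mathcal{B}\subseteq\mathcal{N}_b,\,|\mathcal{B}|=B}C_f^{\mathcal{B}}$. It is assumed throughout that $C_f:=C_f^{\mathcal{N}_b}$ is finite (hence so are all $C_f^{\mathcal{B}}$ and $\bar C_f^{B}$). *)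

(* Defs.v *)
From HB Require Import structures.
From mathcomp Require Import all_boot all_order all_algebra finmap.
From mathcomp Require Import all_classical all_reals all_analysis.

Set Implicit Arguments.
Unset Strict Implicit.
Unset Printing Implicit Defensive.

Import Order.TTheory GRing.Theory Num.Theory.
Import numFieldNormedType.Exports.

Local Open Scope classical_set_scope.
Local Open Scope ring_scope.

Section BlockFrankWolfe.
Context {R : realType} {Nb : nat} {dim : 'I_Nb -> nat}.

(* A vector of R^d, d = \sum_n dim n, whose n-th block is [submxrow x n]. *)
Local Notation E := 'rV[R]_(\sum_(n < Nb) dim n).

Implicit Types (f : E -> R) (X : forall n, set 'rV[R]_(dim n)).

Definition dotv m (u v : 'rV[R]_m) : R := \sum_(i < m) u 0 i * v 0 i.

Definition grad f (x : E) : E := \row_i 'D_(delta_mx 0 i) f x.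

Definition partial_grad f (x : E) (n : 'I_Nb) : 'rV[R]_(dim n) :=
  submxrow (grad f x) n.

Definition feasible X : set E := [set x | forall n, X n (submxrow x n)].

(* A real supremum: the set is nonempty and bounded when the [X n] are
   nonempty and compact and [x] is feasible. *)
Definition duality_gap f X (x : E) : R :=
  sup [set dotv (x - s) (grad f x) | s in feasible X].

Definition block_step (S : {set 'I_Nb}) (gam : R) (x : E)
    (s : forall n, 'rV[R]_(dim n)) : E :=
  \mxrow_n (if n \in S then (1 - gam) *: submxrow x n + gam *: s n
            else submxrow x n).

(* Only the blocks [s n] with [n \in S] are used, hence constrained. *)
Definition curvature f X (S : {set 'I_Nb}) : \bar R :=
  ereal_sup [set c | exists gam x s,
    [/\ 0 < gam <= 1, feasible X x, (forall n, n \in S -> X n (s n)) &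
        c = (let y := block_step S gam x s in
             2 / gam ^+ 2 *
               (f y - f x -
                \sum_(n in S) dotv (submxrow y n - submxrow x n)
                                   (partial_grad f x n)))%:E]].

Definition expected_curvature f X (B : nat) : \bar R :=
  (('C(Nb, B)%:R^-1)%:E *
     \sum_(S : {set 'I_Nb} | #|S| == B) curvature f X S)%E.

Fixpoint step_size (alpha : R) (t : nat) : R :=
  if t is t'.+1 then
    let gam := step_size alpha t' in
    (Num.sqrt (alpha ^+ 2 * gam ^+ 4 + 4 * gam ^+ 2) - alpha * gam ^+ 2) / 2
  else 1.

(* The draws [D 0], [D 1], ... are random variables with values in the finite
   type {set 'I_Nb} (discrete sigma-algebra), each uniform on the B-element
   subsets, and mutually independent. *)
Definition uniform_draws (disp : measure_display) (Omega : measurableType disp)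
    (P : probability Omega R) (B : nat) (D : nat -> Omega -> {set 'I_Nb}) :
    Prop :=
  [/\ (forall t (A : set {set 'I_Nb}), measurable (D t @^-1` A)),
      (forall t (S : {set 'I_Nb}),
         P (D t @^-1` [set S]) =
         (if #|S| == B then ('C(Nb, B)%:R^-1)%:E else 0%E)) &
      (forall (J : {fset nat}) (A : nat -> set {set 'I_Nb}),
         P (\bigcap_(j in [set` J]) (D j @^-1` A j)) =
         (\prod_(j <- J) P (D j @^-1` A j))%E)].

Definition is_argmin m (A : set 'rV[R]_m) (phi : 'rV[R]_m -> R)
    (s : 'rV[R]_m) : Prop :=
  A s /\ forall u, A u -> phi s <= phi u.

(* [x t] and [s t] are the iterate and the selected minimizers at time [t].
   Ties are broken arbitrarily; the last clause says that the selection at time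
   [t] is a function of the draws [D 0], ..., [D t]. *)
Definition block_frank_wolfe (Omega : Type) f X (gam : nat -> R) (x0 : E)
    (D : nat -> Omega -> {set 'I_Nb}) (x : nat -> Omega -> E)
    (s : nat -> Omega -> forall n, 'rV[R]_(dim n)) : Prop :=
  [/\ (forall w, x 0%N w = x0),
      (forall t w n, n \in D t w ->
         is_argmin (X n) (fun u => dotv u (partial_grad f (x t w) n))
           (s t w n)),
      (forall t w, x t.+1 w = block_step (D t w) (gam t) (x t w) (s t w)) &
      (forall t w w', (forall k, (k <= t)%N -> D k w = D k w') ->
         forall n, n \in D t w -> s t w n = s t w' n)].

End BlockFrankWolfe.

(* Main.v *)
(* Write e_k = E[h(x^k)] and g_k = E[g(x^k)].  The duality gap is the sum of its
   block contributions, the iterate x^k depends on the first k draws only, and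
   each block is drawn with probability alpha; hence the curvature bound,
   averaged over the k-th draw, gives
     e_{k+1} <= e_k - alpha gamma_k g_k + gamma_k^2 C / 2.
   Convexity gives e_k <= g_k, and the step sizes are built so that
   gamma_{k+1}^2 = (1 - alpha gamma_{k+1}) gamma_k^2: dividing the recursion by
   gamma_k^2 makes it telescope.  Both bounds then follow from
   1 / (alpha k + 1) <= gamma_k <= 2 / (alpha k + 2). *)
Require Import Defs.
From HB Require Import structures.
From mathcomp Require Import all_boot all_order all_algebra finmap.
From mathcomp Require Import all_classical all_reals all_analysis.
From mathcomp Require Import ring lra zify.

Set Implicit Arguments.
Unset Strict Implicit.
Unset Printing Implicit Defensive.

Import Order.TTheory GRing.Theory Num.Theory.
Import numFieldNormedType.Exports.

Local Open Scope classical_set_scope.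
Local Open Scope ring_scope.

(** * Step sizes and the scalar recursion *)

Section StepSize.
Context {R : realType} (alpha : R).
Hypotheses (alpha_gt0 : 0 < alpha) (alpha_le1 : alpha <= 1).
Local Notation gam := (step_size alpha).

Lemma step_size_gt0 t : 0 < gam t.
Proof.
elim: t => [|t IH] /=; first exact: ltr01.
rewrite divr_gt0// subr_gt0 -(ltr_pXn2r (n := 2))// ?nnegrE ?sqrtr_ge0//;
  last first.
  by rewrite mulr_ge0 ?sqr_ge0// ltW.
have q0 : 0 < gam t ^+ 2 by rewrite exprn_gt0.
by rewrite sqr_sqrtr; nra.
Qed.

(** The next step size is the positive root of [z ^+ 2 + alpha * gam t ^+ 2 * z - gam t ^+ 2]. *)
Lemma step_size_rec t : gam t.+1 ^+ 2 = (1 - alpha * gam t.+1) * gam t ^+ 2.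
Proof.
rewrite /=; set r := Num.sqrt _.
have : r ^+ 2 = alpha ^+ 2 * gam t ^+ 4 + 4 * gam t ^+ 2.
  by rewrite sqr_sqrtr//; have := sqr_ge0 (gam t); nra.
by move=> h; nra.
Qed.

Lemma step_size_le t : gam t.+1 <= gam t.
Proof.
rewrite -(ler_pXn2r (n := 2))// ?nnegrE ?(ltW (step_size_gt0 _))//.
have := step_size_rec t; have := step_size_gt0 t.+1; have := sqr_ge0 (gam t).
move=> q0 b0 ->; rewrite ler_piMl// lerBlDr lerDl mulr_ge0// ltW//.
Qed.

Lemma step_size_nonincreasing m n : (m <= n)%N -> gam n <= gam m.
Proof.
by move=> /subnK <-; elim: (_ - _)%N => // k IH;
  apply: le_trans (step_size_le _) IH.
Qed.

Lemma step_size_le1 t : gam t <= 1.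
Proof. exact: (@step_size_nonincreasing 0). Qed.

(** Equivalently, [1 / gam] grows by at least [alpha / 2] and at most [alpha] per step. With
    [a = gam t] and [b = gam t.+1], the recursion reads [(a + b) * (a - b) = alpha * b * a ^+ 2],
    and [a <= a + b <= 2 * a]. *)
Lemma step_size_diff t :
  alpha * gam t * gam t.+1 / 2 <= gam t - gam t.+1 <= alpha * gam t * gam t.+1.
Proof.
have a0 := step_size_gt0 t; have b0 := step_size_gt0 t.+1.
have ba := step_size_le t; have rec := step_size_rec t.
move: (gam t) (gam t.+1) a0 b0 ba rec => a b a0 b0 ba rec.
have ab0 : 0 < a + b by rewrite addr_gt0.
have fac : (a + b) * (a - b) = alpha * b * a * a by rewrite mulrC -subr_sqr
  rec; ring.
have c0 : 0 <= alpha * b * a by rewrite !mulr_ge0// ltW.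
have h1 := ler_wpM2l c0 ba; have h2 := mulr_ge0 c0 (ltW b0).
by apply/andP; split; rewrite -(ler_pM2l ab0) fac; move: h1 h2; nra.
Qed.

Lemma step_size_upper t : gam t * (alpha * t%:R + 2) <= 2.
Proof.
elim: t => [|t IH]; first by rewrite mulr0 add0r mul1r.
have /andP[dif _] := step_size_diff t.
have a0 := step_size_gt0 t; have b0 := step_size_gt0 t.+1.
(* Multiplied by [gam t], the goal is the sum of the induction hypothesis times [gam t.+1] and twice
   the difference bound. *)
rewrite -(ler_pM2l a0) -natr1.
move: (gam t) (gam t.+1) (t%:R : R) a0 b0 dif IH => a b u a0 b0 dif IH.
nra.
Qed.

Lemma step_size_lower t : 1 <= gam t * (alpha * t%:R + 1).
Proof.
elim: t => [|t IH]; first by rewrite mulr0 add0r mul1r.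
have /andP[_ dif] := step_size_diff t.
have a0 := step_size_gt0 t; have b0 := step_size_gt0 t.+1.
rewrite -(ler_pM2l a0) -natr1.
move: (gam t) (gam t.+1) (t%:R : R) a0 b0 dif IH => a b u a0 b0 dif IH.
nra.
Qed.

(** * Rates that follow from the descent inequality *)

Section Recursion.
Variables (e g : nat -> R) (C : R).
Hypotheses (e_ge0 : forall k, 0 <= e k) (e_le_g : forall k, e k <= g k).
Hypothesis C_ge0 : 0 <= C.
Hypothesis descent : forall k,
  e k.+1 <= e k - alpha * gam k * g k + gam k ^+ 2 / 2 * C.

(** The ratio [e k.+1 / gam k ^+ 2] grows by at most [C / 2] per step. The step from [e 0], where
    [gam 0 = 1], produces the factor [1 - alpha]. *)
Lemma descent_rate t :
  e t.+1 <= gam t ^+ 2 * ((1 - alpha) * e 0%N + t.+1%:R * C / 2).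
Proof.
elim: t => [|t IH].
  have := descent 0; have := ler_wpM2l (ltW alpha_gt0) (e_le_g 0).
  by rewrite /= !expr1n !mulr1 !mul1r; lra.
have := descent t.+1; have := e_le_g t.+1; have := step_size_rec t.
have := step_size_gt0 t.+1; have := step_size_gt0 t.
have : alpha * gam t.+1 <= 1.
  by rewrite mulr_ile1// ?step_size_le1// ltW// step_size_gt0.
rewrite -[t.+2%:R]natr1.
move: (gam t) (gam t.+1) (e t.+1) (e t.+2) (g t.+1) IH => a b e1 e2 g1 IH.
set K := (1 - alpha) * _; set n := t.+1%:R in IH *.
move=> ab1 a0 b0 rec eg des.
have h1 : e2 <= (1 - alpha * b) * e1 + b ^+ 2 / 2 * C.
  have : alpha * b * e1 <= alpha * b * g1.
    by rewrite ler_pM2l// mulr_gt0.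
  lra.
have h2 : (1 - alpha * b) * e1 <= b ^+ 2 * (K + n * C / 2).
  by rewrite rec -[leRHS]mulrA; apply: ler_wpM2l IH; rewrite subr_ge0.
apply: le_trans h1 _; lra.
Qed.

Lemma descent_rate_explicit t : (0 < t)%N ->
  e t <= 4 * (1 - alpha) * e 0%N / (alpha * t%:R + 2 - alpha) ^+ 2
         + 2 * t%:R / (alpha * t%:R + 2 - alpha) ^+ 2 * C.
Proof.
case: t => // t _; apply: le_trans (descent_rate t) _.
(* The value at time [t.+1] is controlled by [gam t]; this shift of index is the [- alpha] in the
   denominator. *)
have -> : alpha * t.+1%:R + 2 - alpha = alpha * t%:R + 2.
  by rewrite -natr1; ring.
have d0 : 0 < alpha * t%:R + 2 by rewrite ltr_wpDl// mulr_ge0// ltW.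
set K := _ + t.+1%:R * C / 2.
have K0 : 0 <= K by rewrite addr_ge0 ?divr_ge0 ?mulr_ge0 ?subr_ge0.
have -> : 4 * (1 - alpha) * e 0%N / (alpha * t%:R + 2) ^+ 2
         + 2 * t.+1%:R / (alpha * t%:R + 2) ^+ 2 * C
        = (2 / (alpha * t%:R + 2)) ^+ 2 * K.
  by rewrite /K; field; rewrite gt_eqF.
rewrite ler_wpM2r// ler_pXn2r//
  ?nnegrE ?(ltW (step_size_gt0 _)) ?divr_ge0 ?(ltW d0)//.
by rewrite ler_pdivlMr// step_size_upper.
Qed.

Lemma descent_telescope m n : (m <= n)%N ->
  \sum_(m <= k < n) alpha * gam k * g k <=
    e m + \sum_(m <= k < n) gam k ^+ 2 / 2 * C.
Proof.
move=> mn; rewrite -lerBlDr -sumrB.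
apply: (@le_trans _ _ (\sum_(m <= k < n) (e k - e k.+1))).
  by apply: ler_sum => k _; have := descent k; lra.
rewrite (@telescope_sumr_eq _ _ _ (fun k => - e k))// => [|k _].
  by rewrite opprK addrC gerBl.
by rewrite opprK addrC.
Qed.

(* Averaging the descent inequality over the window [m+1 .. t] and bounding the
   value at its left end by [descent_rate] leaves the factor
   [1 / ((t - m) (alpha m + 2)^2)], which [m ~ 2t/3] minimizes; this is the
   source of the constant 27. *)
Lemma descent_gap t : (0 < t)%N ->
  exists k : 'I_t.+1, g k <= 27 * (alpha * t%:R + 1)
    / (2 * alpha ^+ 3 * t%:R ^+ 3)
    * (t.+1%:R * C + 2 * (1 - alpha) * e 0%N).
Proof.
move=> t0; pose m := ((2 * t) %/ 3)%N.
have mt : (m < t)%N by rewrite /m; lia.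
case: (@arg_minP _ _ _ (@ord0 t) xpredT (fun i : 'I_t.+1 => g i)) => //
  k _ kmin.
exists k => //; set G := g k; set M := _ + 2 * (1 - alpha) * e 0%N.
have G0 : 0 <= G by apply: le_trans (e_le_g _).
have M0 : 0 <= M by rewrite addr_ge0 ?mulr_ge0 ?subr_ge0.
have tR0 : 0 < t%:R :> R by rewrite ltr0n.
have at0 : 0 < alpha * t%:R by rewrite mulr_gt0.
pose N : R := (t - m)%:R; have N0 : 0 <= N by [].
(* On the window, [gam t] is the least step size and [G] the least gap, which bounds the sum from
   below; [gam m] bounds every step size from above. The [m.+1] curvature terms in the bound on
   [e m.+1] and the [t - m] of the window add up to [t.+1]. *)
have sum_le : alpha * gam t * G * N <= gam m ^+ 2 * (M / 2).
  apply: (@le_trans _ _ (\sum_(m.+1 <= i < t.+1) alpha * gam i * g i)).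
    have <- : \sum_(m.+1 <= i < t.+1) alpha * gam t * G = alpha * gam t * G * N.
      by rewrite sumr_const_nat subSS mulr_natr.
    apply: ler_sum_nat => i /andP[_ it].
    rewrite -!mulrA ler_pM2l// ler_pM ?(ltW (step_size_gt0 _))//.
      exact: step_size_nonincreasing.
    exact: (kmin (Ordinal it)).
  apply: le_trans (descent_telescope _) _; first by rewrite ltnS ltnW.
  apply: (@le_trans _ _ (gam m ^+ 2 * ((1 - alpha) * e 0%N + m.+1%:R * C / 2)
      + \sum_(m.+1 <= i < t.+1) gam m ^+ 2 / 2 * C)).
    apply: lerD; first exact: descent_rate.
    apply: ler_sum_nat => i /andP[mi _].
    rewrite ler_wpM2r// ler_pM2r ?invr_gt0// ler_pXn2r//
      ?nnegrE ?(ltW (step_size_gt0 _))//.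
    by apply: step_size_nonincreasing; exact: ltnW.
  rewrite sumr_const_nat subSS -[_ *+ (t - m)]mulr_natr natrB ?(ltnW mt)//.
  by rewrite le_eqVlt; apply/orP; left; apply/eqP; rewrite /M -!natr1; field.
pose q := alpha * m%:R + 2.
have q0 : 0 < q by rewrite ltr_wpDl// mulr_ge0// ltW.
(* Here [27 = 3 * 3 ^ 2]: one factor from [t <= 3 * N], two from the square of
   [2 * alpha * t <= 3 * q]. The constant 2 in [q] absorbs the rounding of [m]. *)
have qN : 4 * alpha ^+ 2 * t%:R ^+ 3 <= 27 * (N * q ^+ 2).
  have tN : t%:R <= 3 * N by rewrite -natrM ler_nat /m; lia.
  have tq : 2 * (alpha * t%:R) <= 3 * q.
    have : (2 * t)%:R <= (3 * m.+1)%:R :> R by rewrite ler_nat /m; lia.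
    rewrite !natrM -[m.+1%:R]natr1 => h; have := ler_wpM2l (ltW alpha_gt0) h.
    by have := alpha_le1; rewrite /q; lra.
  have tq2 : (2 * (alpha * t%:R)) ^+ 2 <= (3 * q) ^+ 2.
    by rewrite ler_pXn2r// nnegrE mulr_ge0// ltW.
  have := ler_pM (ltW tR0) (sqr_ge0 _) tN tq2.
  by congr (_ <= _); ring.
(* In [sum_le], [step_size_lower] eliminates [gam t] on the left and [step_size_upper] eliminates
   [gam m] on the right. *)
have GN : alpha * G * N * q ^+ 2 <= 2 * (alpha * t%:R + 1) * M.
  apply: (@le_trans _ _ (alpha * gam t * G * N * ((alpha * t%:R + 1)
    * q ^+ 2))).
    rewrite [leRHS](_ : _ = (gam t * (alpha * t%:R + 1))
      * (alpha * G * N * q ^+ 2)); last by ring.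
    by rewrite ler_peMl ?step_size_lower// !mulr_ge0 ?sqr_ge0// ltW.
  have c0 : 0 <= (alpha * t%:R + 1) * q ^+ 2.
    by rewrite mulr_ge0 ?sqr_ge0 ?addr_ge0 ?(ltW at0).
  apply: le_trans (ler_wpM2r c0 sum_le) _.
  rewrite [leLHS](_ : _ = (gam m * q) ^+ 2 * ((alpha * t%:R + 1) * (M / 2)));
    last by ring.
  have g2 : (gam m * q) ^+ 2 <= 2 ^+ 2.
    by rewrite ler_pXn2r ?nnegrE ?step_size_upper//
      mulr_ge0 ?(ltW (step_size_gt0 _))// ltW.
  have d0 : 0 <= (alpha * t%:R + 1) * (M / 2).
    by apply: mulr_ge0; [rewrite addr_ge0// ltW | exact: divr_ge0].
  apply: le_trans (ler_wpM2r d0 g2) _.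
  by rewrite le_eqVlt; apply/orP; left; apply/eqP; field.
rewrite mulrAC ler_pdivlMr ?mulr_gt0 ?exprn_gt0//.
have aG0 : 0 <= alpha * G / 2 by rewrite divr_ge0 ?mulr_ge0 ?(ltW alpha_gt0).
have := ler_wpM2l aG0 qN; move: GN.
rewrite (_ : G * _ = alpha * G / 2 * (4 * alpha ^+ 2 * t%:R ^+ 3));
  last by field.
rewrite (_ : alpha * G / 2 * (27 * _) = 27 / 2 * (alpha * G * N * q ^+ 2));
  last by field.
lra.
Qed.
End Recursion.
End StepSize.

(** * Gradients, block gaps and curvature *)

Section Geometry.
Context {R : realType} {Nb : nat} {dim : 'I_Nb -> nat}.
Local Notation E := 'rV[R]_(\sum_(n < Nb) dim n).
Implicit Types (f : E -> R) (X : forall n, set 'rV[R]_(dim n))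
  (S : {set 'I_Nb}) (gam : R) (s : forall n, 'rV[R]_(dim n)).

Lemma dotvE m (u v : 'rV[R]_m) : dotv u v = (u *m v^T) 0 0.
Proof. by rewrite /dotv mxE; apply: eq_bigr => i _; rewrite mxE. Qed.

Lemma dotvBl m (u v w : 'rV[R]_m) : dotv (u - v) w = dotv u w - dotv v w.
Proof. by rewrite !dotvE mulmxBl !mxE. Qed.

Lemma dotvNl m (u w : 'rV[R]_m) : dotv (- u) w = - dotv u w.
Proof. by rewrite !dotvE mulNmx !mxE. Qed.

Lemma dotvZl m a (u w : 'rV[R]_m) : dotv (a *: u) w = a * dotv u w.
Proof. by rewrite !dotvE -scalemxAl !mxE. Qed.

Lemma dotv0l m (w : 'rV[R]_m) : dotv 0 w = 0.
Proof. by rewrite dotvE mul0mx mxE. Qed.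

Lemma dotv_blocks (u v : E) :
  dotv u v = \sum_n dotv (submxrow u n) (submxrow v n).
Proof.
rewrite dotvE -{1}(submxrowK u) -{1}(submxrowK v)
  tr_mxrow mul_mxrow_mxcol summxE.
by apply: eq_bigr => n _; rewrite dotvE.
Qed.

Lemma dotv_continuous m (v : 'rV[R]_m) :
  continuous (fun u : 'rV[R]_m => dotv u v).
Proof.
apply: continuous_big => [|i _ u]; first exact: add_continuous.
by apply: (@cvgMr_tmp _ _ (nbhs u)); exact: coord_continuous.
Qed.

Lemma deriveE_grad f (x v : E) :
  differentiable f x -> 'D_v f x = dotv v (grad f x).
Proof.
move=> df; rewrite deriveE// {1}(row_sum_delta v) linear_sum /dotv.
by apply: eq_bigr => i _; rewrite linearZ /= mxE deriveE.
Qed.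

Lemma conv_lmodE (M : lmodType R) (t : {i01 R}) (x y : convex_lmodType M) :
  conv t x y = t%:num *: (x : M) + (1 - t%:num) *: (y : M).
Proof. by []. Qed.

Lemma convex_setP (M : lmodType R) (A : set M) (a : R) (x y : M) :
  convex_set A -> 0 <= a <= 1 -> A x -> A y -> A (a *: x + (1 - a) *: y).
Proof.
move=> cA /andP[a0 a1] Ax Ay.
by have := cA x y (Itv01 a0 a1) (mem_set Ax) (mem_set Ay); rewrite inE.
Qed.

(** By convexity the difference quotients of [f] at [x] towards [y], for [0 < t <= 1], are at most
    [f y - f x]; the directional derivative is their limit from the right. *)
Lemma convex_gradient f (A : set E) (x y : E) :
  convex_function A f -> A x -> A y -> differentiable f x ->
  f x + dotv (y - x) (grad f x) <= f y.
Proof.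
move=> cf Ax Ay df; rewrite -lerBrDl -deriveE_grad//.
have /(@cvg_dnbhs_at_right _ _ _ _ _) h := @diff_derivable _ _ _ f x (y - x) df.
apply: (cvgr_to_le h).
near=> t.
have t0 : 0 < t by [].
have t1 : t <= 1 by near: t; exact: nbhs_right_le.
rewrite /= [_ *: _]/GRing.scale/= mulrC ler_pdivrMr//.
have := cf (Itv01 (ltW t0) t1) y x (mem_set Ay) (mem_set Ax).
rewrite conv_lmodE convRE /= /unstable.onem.
have -> : t *: (y - x) + x = t *: y + (1 - t) *: x.
  by rewrite scalerBr scalerBl scale1r addrAC addrA.
lra.
Unshelve. all: by end_near. Qed.

(* Defined by a supremum rather than at the selected minimizer, so that it is a
   function of the iterate alone and hence independent of the next draw. *)
Definition block_gap f X (x : E) (n : 'I_Nb) : R :=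
  sup [set dotv (submxrow x n - u) (partial_grad f x n) | u in X n].

Lemma has_sup_dotv m (A : set 'rV[R]_m) (a v : 'rV[R]_m) :
  A !=set0 -> compact A -> has_sup [set dotv (a - u) v | u in A].
Proof.
move=> A0 cA; apply: compact_has_sup; first exact: image_nonempty.
apply: continuous_compact => //; apply: continuous_subspaceT => u.
have -> : (fun u => dotv (a - u) v) = (fun u => dotv a v - dotv u v).
  by apply/funext => w; rewrite dotvBl.
by apply: (@cvgB _ _ _ (nbhs u)); [exact: cvg_cst | exact: dotv_continuous].
Qed.

Lemma block_step_blockE (S : {set 'I_Nb}) gam (x : E) s n :
  submxrow (block_step S gam x s) n - submxrow x n =
  if n \in S then gam *: (s n - submxrow x n) else 0.
Proof.
rewrite mxrowK; case: ifP => _; last by rewrite subrr.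
by rewrite scalerBl scale1r scalerBr addrAC [_ - _ *: _ - _]addrAC subrr add0r
  addrC.
Qed.

Lemma curvature_ge f X S gam (x : E) s : 0 < gam <= 1 -> feasible X x ->
  (forall n, n \in S -> X n (s n)) ->
  ((2 / gam ^+ 2 * (f (block_step S gam x s) - f x - \sum_(n in S)
    dotv (submxrow (block_step S gam x s) n - submxrow x n)
      (partial_grad f x n)))%:E <= curvature f X S)%E.
Proof.
by move=> gam01 Xx Xs; apply: ereal_sup_ubound; exists gam, x, s; split.
Qed.

(** Steering each block of [x] to itself leaves [x] in place, so 0 is among the values of which the
    curvature is the supremum. *)
Lemma curvature_ge0 f X S (x : E) : feasible X x -> (0 <= curvature f X S)%E.
Proof.
move=> Xx; have := @curvature_ge f X S 1 x (submxrow x).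
rewrite ltr01 lexx => /(_ isT Xx (fun n _ => Xx n)).
have -> : block_step S 1 x (submxrow x) = x.
  rewrite -[RHS]submxrowK; apply/eq_mxrow => n.
  by rewrite subrr scale0r add0r scale1r if_same.
rewrite subrr big1 ?subr0 ?mulr0// => n _.
by rewrite subrr dotv0l.
Qed.

(** A step on [S] is a full step in which the blocks outside [S] are steered to themselves. *)
Lemma curvature_leT f X S : (curvature f X S <= curvature f X [set: 'I_Nb])%E.
Proof.
apply: ge_ereal_sup => _ [gam [x [s [gam01 Xx Xs ->]]]].
pose s' n := if n \in S then s n else submxrow x n.
have stepE : block_step S gam x s = block_step [set: 'I_Nb] gam x s'.
  apply/eq_mxrow => n; rewrite /s' inE; case: ifP => // _.
  by rewrite -scalerDl subrK scale1r.
cbv zeta; set y := block_step S gam x s.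
have -> : \sum_(n in S) dotv (submxrow y n - submxrow x n)
      (partial_grad f x n) =
    \sum_(n in [set: 'I_Nb]%SET) dotv (submxrow y n - submxrow x n)
      (partial_grad f x n).
  rewrite big_mkcond/= [RHS](eq_bigl xpredT) => [|n]; last by rewrite inE.
  apply: eq_bigr => n _.
  by rewrite block_step_blockE; case: (n \in S) => //; rewrite dotv0l.
rewrite /y stepE; apply: curvature_ge => // n _; rewrite /s'.
by case: ifPn => [/Xs|_] //; exact: Xx.
Qed.

Lemma curvature_fin_num f X S (x : E) : feasible X x ->
  curvature f X [set: 'I_Nb] \is a fin_num -> curvature f X S \is a fin_num.
Proof.
move=> Xx Cfin; rewrite ge0_fin_numE; last exact: curvature_ge0 Xx.
by apply: le_lt_trans (curvature_leT _ _ _) _; rewrite -ge0_fin_numE//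
  (curvature_ge0 _ _ Xx).
Qed.

(** * Gap decomposition and one-step descent over compact blocks *)

Section CompactBlocks.
Variable X : forall n, set 'rV[R]_(dim n).
Arguments X : clear implicits.
Hypotheses (X_neq0 : forall n, X n !=set0)
  (X_convex : forall n, convex_set (X n))
  (X_compact : forall n, compact (X n)).

Lemma feasible_block_step S gam (x : E) s : 0 <= gam <= 1 -> feasible X x ->
  (forall n, n \in S -> X n (s n)) -> feasible X (block_step S gam x s).
Proof.
move=> gam01 Xx Xs n; rewrite mxrowK; case: ifPn => [nS|_]; last exact: Xx.
by rewrite addrC; apply: convex_setP => //; exact: Xs.
Qed.

Lemma dotv_le_block_gaps f (x y : E) : feasible X y ->
  dotv (x - y) (grad f x) <= \sum_n block_gap f X x n.
Proof.
move=> Xy; rewrite dotv_blocks; apply: ler_sum => n _; rewrite submxrowB.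
apply: ub_le_sup; last by exists (submxrow y n).
by have [] := has_sup_dotv (submxrow x n) (partial_grad f x n) (X_neq0 n)
  (@X_compact n).
Qed.

(** A linear function on a product splits over the blocks. The descent subtracts block gaps, so this
    direction lets the duality gap replace them. *)
Lemma duality_gap_le f (x : E) : feasible X x ->
  duality_gap f X x <= \sum_n block_gap f X x n.
Proof.
move=> Xx; apply: ge_sup => [|_ [y Xy <-]]; last exact: dotv_le_block_gaps.
by apply: image_nonempty; exists x.
Qed.

Lemma duality_gap_ge f (x y : E) : feasible X y ->
  dotv (x - y) (grad f x) <= duality_gap f X x.
Proof.
move=> Xy; apply: ub_le_sup; last by exists y.
by exists (\sum_n block_gap f X x n) => _ [z Xz <-]; exact: dotv_le_block_gaps.
Qed.

Lemma subopt_le_duality_gap f (x y : E) : convex_function (feasible X) f ->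
  differentiable f x -> feasible X x -> feasible X y ->
  f x - f y <= duality_gap f X x.
Proof.
move=> cf df Xx Xy; apply: le_trans (duality_gap_ge _ _ Xy).
by have := convex_gradient cf Xx Xy df; rewrite -opprB dotvNl; lra.
Qed.

(** The curvature bounds the error of the linear model at the new point, and each selected minimizer
    realizes its block gap in the linear term. *)
Lemma block_descent f (S : {set 'I_Nb}) gam (x : E) s :
  curvature f X S \is a fin_num -> 0 < gam <= 1 -> feasible X x ->
  (forall n, n \in S ->
     is_argmin (X n) (fun u => dotv u (partial_grad f x n)) (s n)) ->
  f (block_step S gam x s) <= f x - gam * \sum_(n in S) block_gap f X x n
    + gam ^+ 2 / 2 * fine (curvature f X S).
Proof.
move=> Cfin gam01 Xx s_min.
have := curvature_ge f gam01 Xx (fun n nS => (s_min n nS).1).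
rewrite -{1}(fineK Cfin) lee_fin; set y := block_step _ _ _ _.
have gam2 : 0 < gam ^+ 2 by case/andP: gam01 => gam0 _; rewrite exprn_gt0.
rewrite mulrAC ler_pdivrMr// => h.
have sumE :
    \sum_(n in S) dotv (submxrow y n - submxrow x n) (partial_grad f x n) <=
    - (gam * \sum_(n in S) block_gap f X x n).
  rewrite mulr_sumr -sumrN; apply: ler_sum => n nS.
  rewrite block_step_blockE nS dotvZl -mulrN ler_pM2l; last by case/andP: gam01.
  rewrite -opprB dotvNl lerN2; apply: ge_sup; first exact: image_nonempty.
  by move=> _ [u Xu <-]; rewrite !dotvBl lerD2l lerN2; exact: (s_min n nS).2.
move: sumE h; move: (\sum_(n in S) dotv _ _) (gam * _) (fine _) (f y) (f x).
by move=> ? ? ? ? ?; lra.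
Qed.
End CompactBlocks.
End Geometry.

(** * Expectations of functions of the draws *)

Section FiniteExpectation.
Context {R : realType} {disp : measure_display} {Omega : measurableType disp}.
Variable P : probability Omega R.

Lemma integrable_sumR (I : finType) (F : I -> Omega -> R) :
  (forall i, P.-integrable setT (EFin \o F i)) ->
  P.-integrable setT (EFin \o (fun w => \sum_i F i w)).
Proof.
move=> iF; rewrite (_ : EFin \o _ = fun w => (\sum_i (F i w)%:E)%E).
  by apply: integrable_sum => // j _; exact: iF.
by apply/funext => w; rewrite /= sumEFin.
Qed.

Lemma Rintegral_sum (I : finType) (F : I -> Omega -> R) :
  (forall i, P.-integrable setT (EFin \o F i)) ->
  \int[P]_w (\sum_i F i w) = \sum_i \int[P]_w F i w.
Proof.
move=> iF; elim: (index_enum I) => [|i r IH].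
  rewrite big_nil; under eq_Rintegral do rewrite big_nil.
  by rewrite Rintegral_cst// mul0r.
rewrite big_cons -IH -RintegralD//; 
  first by apply: eq_Rintegral => w _; rewrite big_cons.
rewrite (_ : EFin \o _ = fun w => (\sum_(j <- r) (F j w)%:E)%E).
  by apply: integrable_sum => // j _; exact: iF.
by apply/funext => w; rewrite /= sumEFin.
Qed.

Lemma integrable_scale_indic (c : R) (A : set Omega) : measurable A ->
  P.-integrable setT (EFin \o (fun w => c * \1_A w)).
Proof.
by move=> mA; apply: (@integrableZl _ _ _ P setT _ c (EFin \o \1_A)) => //;
  exact: integrable_indic.
Qed.

Lemma Rintegral_scale_indic (c : R) (A : set Omega) : measurable A ->
  \int[P]_w (c * \1_A w) = c * fine (P A).
Proof.
move=> mA; rewrite RintegralZl//; last exact: integrable_indic.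
by rewrite /Rintegral integral_indic// setIT.
Qed.

Lemma expectationE_Rintegral (Z : Omega -> R) :
  P.-integrable setT (EFin \o Z) -> 'E_P[Z]%E = (\int[P]_w Z w)%:E.
Proof.
by move=> iZ; rewrite unlock /Rintegral fineK//; exact: integrable_fin_num.
Qed.

Lemma Rintegral_probability_cst (c : R) : \int[P]_w c = c.
Proof.
rewrite Rintegral_cst// -[RHS]mulr1; congr (_ * _).
by rewrite (_ : fine _ = fine 1%E)//; congr fine; exact: probability_setT.
Qed.

(** Exhibits a function of a finite-valued variable as a combination of indicators, which reduces
    integrals to probabilities of fibers. *)
Lemma preimage_indicE (T : finType) (H : Omega -> T) (G : T -> R) w :
  G (H w) = \sum_h G h * \1_(H @^-1` [set h]) w.
Proof.
rewrite (bigD1 (H w))//= big1 ?addr0 => [|h hw].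
  by rewrite indicE mem_set// mulr1.
by rewrite indicE memNset ?mulr0// => /= e; rewrite e eqxx in hw.
Qed.
End FiniteExpectation.

(** * Independence of a draw from the past *)

Lemma in_fset_iota k t : (k \in [fset j | j in iota 0 t]%fset) = (k < t)%N.
Proof. by rewrite !inE mem_iota. Qed.

Section Draws.
Context {R : realType} {disp : measure_display} {Omega : measurableType disp}.
Variables (P : probability Omega R) (Nb B : nat).
Variable D : nat -> Omega -> {set 'I_Nb}.
Hypothesis D_uniform : uniform_draws P B D.

(** Pointwise form of measurability with respect to the draws before time [t], adequate because they
    take finitely many values. *)
Definition adapted t (Z : Omega -> R) :=
  forall w w', (forall k, (k < t)%N -> D k w = D k w') -> Z w = Z w'.

Lemma adaptedS t Z : adapted t Z -> adapted t.+1 Z.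
Proof. by move=> aZ w w' e; apply: aZ => k kt; apply: e; exact: ltnW. Qed.

Definition history t w : {ffun 'I_t -> {set 'I_Nb}} := [ffun i : 'I_t => D i w].

Lemma adapted_factor t Z : adapted t Z -> exists G, Z = G \o history t.
Proof.
(* Adaptedness makes the chosen representative immaterial; histories that no outcome realizes get
   the default value 0. *)
move=> aZ; exists (fun h => if pselect (exists w, history t w = h) is left e
  then Z (projT1 (cid e)) else 0).
apply/funext => w /=; case: pselect => [e|[]]; last by exists w.
case: (cid e) => w' /= /ffunP e'; apply: aZ => k kt.
by have := e' (Ordinal kt); rewrite !ffunE.
Qed.

(** Puts the event in the product form required by the independence clause of [uniform_draws].
    Quantifying over [i] avoids casting [j] to an ordinal: for [j < t] only the clause on [h] bites,
    for [j = t] only the one on [A]. *)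
Lemma history_fiber t (h : {ffun 'I_t -> {set 'I_Nb}}) (A : set {set 'I_Nb}) :
  history t @^-1` [set h] `&` D t @^-1` A =
  \bigcap_(j in [set` [fset k | k in iota 0 t.+1]%fset])
    (D j @^-1` [set S | (forall i : 'I_t, i = j :> nat -> S = h i) /\
                        (j = t -> A S)]).
Proof.
apply/seteqP; split => [w /= [hw Aw] j /= jt|w /= hw].
  split=> [i <-|-> //]; by rewrite -hw ffunE.
have lt k : (k <= t)%N -> k \in [fset k | k in iota 0 t.+1]%fset.
  by move=> kt; rewrite in_fset_iota.
split; last by have [_] := hw t (lt _ (leqnn _)); exact.
by apply/ffunP => i; rewrite ffunE; have [/(_ i erefl)] :=
  hw i (lt _ (ltnW (ltn_ord i))).
Qed.

Lemma measurable_fiber t h : measurable (history t @^-1` [set h]).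
Proof.
have [mD _ _] := D_uniform.
have := history_fiber h setT; rewrite preimage_setT setIT => ->.
by apply: fin_bigcap_measurable => [|j _]; [exact: finite_fset|exact: mD].
Qed.

Local Notation weight := (fun S : {set 'I_Nb} =>
  if #|S| == B then 'C(Nb, B)%:R^-1 else 0 : R).

Lemma fiber_indep t h S :
  fine (P (history t @^-1` [set h] `&` D t @^-1` [set S])) =
  fine (P (history t @^-1` [set h])) * weight S.
Proof.
have [mD DS indep] := D_uniform.
(* Kept general in [A]: the case [A = setT] computes the probability of the history itself. *)
have fiberP (A : set {set 'I_Nb}) :
    P (history t @^-1` [set h] `&` D t @^-1` A) = (P (D t @^-1` A) *
      \prod_(j <- [fset k | k in iota 0 t]%fset)
        P (D j @^-1` [set S | forall i : 'I_t, i = j :> nat -> S = h i]))%E.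
  rewrite history_fiber indep.
  have -> : [fset k | k in iota 0 t.+1]%fset =
      (t |` [fset k | k in iota 0 t])%fset.
    by apply/fsetP => k; rewrite in_fset1U !in_fset_iota ltnS leq_eqVlt.
  rewrite big_fsetU1/=; last by rewrite in_fset_iota ltnn.
  congr (P _ * _)%E.
    apply/seteqP; split => [w /= [_]|w /= Aw]; first exact.
    by split=> // i it; have := ltn_ord i; rewrite it ltnn.
  rewrite big_seq [RHS]big_seq; apply: eq_bigr => j; rewrite in_fset_iota => jt.
  congr (P _); apply/seteqP; split => [w /= []//|w /= hw]; split=> // jE.
  by rewrite jE ltnn in jt.
have -> : P (history t @^-1` [set h]) =
      (\prod_(j <- [fset k | k in iota 0 t]%fset)
        P (D j @^-1` [set S | forall i : 'I_t, i = j :> nat -> S = h i]))%E.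
  by have := fiberP setT; rewrite !preimage_setT setIT probability_setT mul1e.
rewrite fiberP DS muleC fineM//; last by case: ifP.
  by congr (_ * _); case: ifP.
by elim/big_ind : _ => [//|a b|j _]; [exact: fin_numM|exact: fin_num_measure].
Qed.

(** Such a [Z] is a finite combination of indicators of history fibers, so integrability comes from
    the draws alone, whatever [f] and the tie breaking. *)
Lemma adapted_integrable t Z : adapted t Z -> P.-integrable setT (EFin \o Z).
Proof.
move=> /adapted_factor[G ->].
rewrite (_ : EFin \o _ = EFin \o
    (fun w => \sum_h G h * \1_(history t @^-1` [set h]) w)).
  by apply: integrable_sumR => h; apply: integrable_scale_indic;
    exact: measurable_fiber.
by apply/funext => w /=; rewrite -preimage_indicE.
Qed.

Lemma adapted_draw t Z (phi : {set 'I_Nb} -> R) : adapted t Z ->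
  adapted t.+1 (fun w => Z w * phi (D t w)).
Proof. by move=> aZ w w' e; rewrite (adaptedS aZ e) (e t). Qed.

(** Both sides are expanded over the atoms of the pair formed by the history and the current draw,
    where [fiber_indep] applies. *)
Lemma expect_indep t Z (phi : {set 'I_Nb} -> R) : adapted t Z ->
  \int[P]_w (Z w * phi (D t w)) = \int[P]_w Z w * \sum_S phi S * weight S.
Proof.
have [mD DS _] := D_uniform.
move=> /adapted_factor[G ->].
have -> : \int[P]_w (G \o history t) w =
    \sum_h G h * fine (P (history t @^-1` [set h])).
  under eq_Rintegral do rewrite /= preimage_indicE.
  rewrite Rintegral_sum => [|h]; last first.
    by apply: integrable_scale_indic; exact: measurable_fiber.
  by apply: eq_bigr => h _; apply: Rintegral_scale_indic;
    exact: measurable_fiber.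
have -> : (fun w => (G \o history t) w * phi (D t w)) = 
    (fun w => \sum_(hS : _ * _) (G hS.1 * phi hS.2) *
      \1_(history t @^-1` [set hS.1] `&` D t @^-1` [set hS.2]) w).
  apply/funext => w /=; rewrite [G _]preimage_indicE (preimage_indicE (D t)).
  rewrite big_distrlr/= pair_bigA/=; apply: eq_bigr => -[h S] _ /=.
  by rewrite indicI /= mulrACA.
rewrite Rintegral_sum => [|hS]; last first.
  by apply: integrable_scale_indic; apply: measurableI;
    [exact: measurable_fiber|exact: mD].
rewrite big_distrlr/= pair_bigA/=; apply: eq_bigr => -[h S] _ /=.
rewrite Rintegral_scale_indic; last first.
  by apply: measurableI; [exact: measurable_fiber|exact: mD].
by rewrite fiber_indep mulrACA.
Qed.

Lemma expect_draw t (phi : {set 'I_Nb} -> R) :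
  \int[P]_w phi (D t w) = \sum_S phi S * weight S.
Proof.
under eq_Rintegral do rewrite -[phi _]mul1r.
rewrite (@expect_indep t (fun=> 1) phi)//.
by rewrite Rintegral_probability_cst mul1r.
Qed.
End Draws.

(** * Block inclusion probabilities and the averaged curvature *)

Lemma card_draws_mem (N B : nat) (n : 'I_N) : (0 < B)%N ->
  #|[set S : {set 'I_N} | (n \in S) && (#|S| == B)]%SET| = 'C(N.-1, B.-1).
Proof.
case: B N n => // B [|N] n _; first by case: n.
have all : #|[set S : {set 'I_N.+1} | #|S| == B.+1]%SET| = 'C(N.+1, B.+1).
  rewrite -[X in 'C(X, _)](card_ord N.+1) -cardsT -cards_draws.
  by apply: eq_card => S; rewrite !inE finset.subsetT.
have out : #|[set S : {set 'I_N.+1} | (n \notin S) && (#|S| == B.+1)]%SET| =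
  'C(N, B.+1).
  rewrite -[X in 'C(X, _)](_ : #|(~: [set n])%SET| = N);
    last by rewrite cardsC1 card_ord.
  rewrite -cards_draws; apply: eq_card => S; rewrite !inE.
  by rewrite finset.subsetC finset.sub1set inE.
move: all; rewrite binS -out /=.
rewrite -(cardsID [set S : {set 'I_N.+1} | n \in S]%SET).
rewrite (_ : _ :&: _ =
  [set S : {set 'I_N.+1} | (n \in S) && (#|S| == B.+1)])%SET; last first.
  by apply/setP => S; rewrite !inE andbC.
rewrite (_ : _ :\: _ =
  [set S : {set 'I_N.+1} | (n \notin S) && (#|S| == B.+1)])%SET; last first.
  by apply/setP => S; rewrite !inE.
by rewrite addnC => /addnI.
Qed.

(** This is where [alpha] arises as a probability: the ratio of binomials is simplified by
    [mul_bin_diag]. *)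
Lemma draw_mem_prob (R : realType) (N B : nat) (n : 'I_N) : (0 < B <= N)%N ->
  \sum_(S : {set 'I_N}) (n \in S)%:R * (if #|S| == B then 'C(N, B)%:R^-1 else 0)
    = B%:R / N%:R :> R.
Proof.
move=> /andP[B0 BN].
have N0 : (0 < N)%N := leq_trans B0 BN.
rewrite (eq_bigr (fun S : {set 'I_N} =>
  if (n \in S) && (#|S| == B) then 'C(N, B)%:R^-1 else 0)); last first.
  by move=> S _; case: (n \in S); rewrite ?mul1r ?mul0r.
rewrite -big_mkcond sumr_const.
have -> : #|[pred S : {set 'I_N} | (n \in S) && (#|S| == B)]| = 'C(N.-1, B.-1).
  by rewrite -(card_draws_mem n B0) cardsE.
rewrite -[_^-1 *+ _]mulr_natl; apply/eqP;
  rewrite eqr_div ?pnatr_eq0 -?lt0n ?bin_gt0//.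
by rewrite -!natrM mulnC mul_bin_diag prednK.
Qed.

(** Brings the average to the shape of [expect_draw], so that it is the mean curvature of the drawn
    set. *)
Lemma expected_curvatureE (R : realType) (Nb : nat) (dim : 'I_Nb -> nat)
  (f : 'rV[R]_(\sum_(n < Nb) dim n) -> R)
  (X : forall n, set 'rV[R]_(dim n)) (B : nat) :
  (forall S, curvature f X S \is a fin_num) ->
  expected_curvature f X B = (\sum_S fine (curvature f X S) *
    (if #|S| == B then 'C(Nb, B)%:R^-1 else 0))%:E.
Proof.
move=> Cfin; rewrite /expected_curvature.
rewrite (eq_bigr (fun S => (fine (curvature f X S))%:E)) => [|S _];
  last by rewrite fineK.
rewrite sumEFin -EFinM mulr_sumr big_mkcond; congr _%:E; apply: eq_bigr => S _.
by case: ifP; rewrite ?mulr0// mulrC.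
Qed.

(** * Expected descent along the run and the two resulting bounds *)

Theorem corollary2 (R : realType)
  (Nb : nat) (hNb : (1 <= Nb)%N)
  (B : nat) (hB : (1 <= B <= Nb)%N)
  (alpha : R) (halpha : alpha = B%:R / Nb%:R)
  (dim : 'I_Nb -> nat)
  (X : forall n : 'I_Nb, set 'rV[R]_(dim n))
  (hX0 : forall n, X n !=set0)
  (hXconvex : forall n, convex_set (X n))
  (hXcompact : forall n, compact (X n))
  (f : 'rV[R]_(\sum_(n < Nb) dim n) -> R)
  (hfdiff : exists U : set 'rV[R]_(\sum_(n < Nb) dim n),
     [/\ open U, feasible X `<=` U & forall x, U x -> differentiable f x])
  (hfconvex : convex_function (feasible X) f)
  (xstar : 'rV[R]_(\sum_(n < Nb) dim n))
  (hxstar : feasible X xstar)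
  (hxstar_min : forall x, feasible X x -> f xstar <= f x)
  (hCf : curvature f X [set: 'I_Nb] \is a fin_num)
  (disp : measure_display) (Omega : measurableType disp)
  (P : probability Omega R)
  (D : nat -> Omega -> {set 'I_Nb}) (hD : uniform_draws P B D)
  (x0 : 'rV[R]_(\sum_(n < Nb) dim n)) (hx0 : feasible X x0)
  (x : nat -> Omega -> 'rV[R]_(\sum_(n < Nb) dim n))
  (s : nat -> Omega -> forall n : 'I_Nb, 'rV[R]_(dim n))
  (hrun : block_frank_wolfe f X (step_size alpha) x0 D x s)
  (t : nat) (ht : (1 <= t)%N) :
  ('E_P[fun w => (f (x t w) - f xstar)%R] <=
     (4 * (1 - alpha) * (f x0 - f xstar) /
        (alpha * t%:R + 2 - alpha) ^+ 2)%:E +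
     (2 * t%:R / (alpha * t%:R + 2 - alpha) ^+ 2)%:E *
        expected_curvature f X B)%E
  /\
  (\big[Order.min/+oo]_(k < t.+1) 'E_P[fun w => duality_gap f X (x k w)] <=
     (27 * (alpha * t%:R + 1) / (2 * alpha ^+ 3 * t%:R ^+ 3))%:E *
       (t.+1%:R%:E * expected_curvature f X B +
        (2 * (1 - alpha) * (f x0 - f xstar))%:E))%E.
Proof.
have [U [_ XU dfU]] := hfdiff.
have df y : feasible X y -> differentiable f y by move=> /XU /dfU.
have [x_init s_min x_step s_draws] := hrun.
have /andP[B_gt0 B_le] := hB.
have a_gt0 : 0 < alpha by rewrite halpha divr_gt0 ?ltr0n.
have a_le1 : alpha <= 1 by rewrite halpha ler_pdivrMr ?ltr0n// mul1r ler_nat.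
have Cfin S : curvature f X S \is a fin_num by exact: curvature_fin_num hx0 hCf.
have s_feas k w n : n \in D k w -> X n (s k w n) by move=> /s_min[].
have gam01 k : 0 < step_size alpha k <= 1.
  by rewrite step_size_gt0// step_size_le1.
have x_feas k w : feasible X (x k w).
  elim: k => [|k IH]; first by rewrite x_init.
  rewrite x_step; apply: feasible_block_step => // [|n]; last exact: s_feas.
  by have /andP[/ltW -> ->] := gam01 k.
(* The selection at time [k] may use [D k], but it first enters [x k.+1]; hence [x k] is fixed by
   the draws strictly before [k]. *)
have x_adapted k w w' : 
    (forall j, (j < k)%N -> D j w = D j w') -> x k w = x k w'.
  elim: k => [|k IH] e; first by rewrite !x_init.
  rewrite !x_step -(e k)// (IH (fun j jk => e j (ltnW jk))).
  apply/eq_mxrow => n; case: ifP => // nD.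
  by rewrite (s_draws k w w' _ n nD)// => j jk; apply: e.
have x_int k (phi : 'rV[R]_(\sum_(n < Nb) dim n) -> R) :
    P.-integrable setT (EFin \o (fun w => phi (x k w))).
  by apply: (adapted_integrable hD (t := k)) => w w' /x_adapted ->.
pose h (y : 'rV[R]_(\sum_(n < Nb) dim n)) := f y - f xstar.
pose e k := \int[P]_w h (x k w).
pose g k := \int[P]_w duality_gap f X (x k w).
pose C : R := \sum_S fine (curvature f X S)
  * (if #|S| == B then 'C(Nb, B)%:R^-1 else 0).
have e_ge0 k : 0 <= e k.
  by apply: Rintegral_ge0 => w _; rewrite subr_ge0 hxstar_min.
have e_le_g k : e k <= g k.
  apply: le_Rintegral => // w _.
  by apply: subopt_le_duality_gap => //; exact: df.
have C_ge0 : 0 <= C.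
  apply: sumr_ge0 => S _; apply: mulr_ge0; last by case: ifP.
  by rewrite fine_ge0// (curvature_ge0 _ _ hx0).
have descent k : e k.+1 <= e k - alpha * step_size alpha k * g k
    + step_size alpha k ^+ 2 / 2 * C.
  set ga := step_size alpha k.
  pose b n w := block_gap f X (x k w) n.
  have b_ad n : adapted D k (b n) by move=> w w' /x_adapted; rewrite /b => ->.
  have gap_int n : P.-integrable setT
      (EFin \o (fun w => b n w * (n \in D k w)%:R)).
    exact: (adapted_integrable hD (adapted_draw (fun S => (n \in S)%:R)
      (b_ad n))).
  have curv_int : P.-integrable setT
      (EFin \o (fun w => fine (curvature f X (D k w)))).
    by apply: (adapted_integrable hD (t := k.+1)) => w w' e_draw;
      rewrite (e_draw k).
  have g_le : g k <= \sum_n \int[P]_w b n w.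
    rewrite -Rintegral_sum => [|n];
      last exact: (x_int k (fun y => block_gap f X y n)).
    apply: le_Rintegral => // [|w _].
      exact: (x_int k (fun y => \sum_n block_gap f X y n)).
    exact: duality_gap_le.
  have sum_int : P.-integrable setT
      (EFin \o (fun w => \sum_n b n w * (n \in D k w)%:R)).
    exact: integrable_sumR.
  have upd_int : P.-integrable setT (EFin \o (fun w => h (x k w)
      - ga * \sum_n b n w * (n \in D k w)%:R)).
    exact: (integrableB measurableT (x_int k h)
      (integrableZl measurableT ga sum_int)).
  have curvZ_int : P.-integrable setT (EFin \o (fun w =>
      ga ^+ 2 / 2 * fine (curvature f X (D k w)))).
    exact: (integrableZl measurableT (ga ^+ 2 / 2) curv_int).
  apply: (@le_trans _ _ (\int[P]_w (h (x k w)
      - ga * (\sum_n b n w * (n \in D k w)%:R)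
      + ga ^+ 2 / 2 * fine (curvature f X (D k w))))).
    apply: le_Rintegral => // [|w _].
      exact: (integrableD measurableT upd_int curvZ_int).
    rewrite /h x_step.
    have := block_descent hX0 (Cfin (D k w)) (gam01 k) (x_feas k w) (s_min k w).
    (* The indicator form separates the block gaps, fixed by the past, from the draw [D k]. *)
    have -> : \sum_n b n w * (n \in D k w)%:R =
        \sum_(n in D k w) block_gap f X (x k w) n.
      by rewrite [RHS]big_mkcond; apply: eq_bigr => n _; case: ifP;
        rewrite ?mulr1 ?mulr0.
    by rewrite -/ga; lra.
  rewrite RintegralD// RintegralB//;
    last exact: (integrableZl measurableT ga sum_int).
  rewrite (RintegralZl ga measurableT sum_int)
    (RintegralZl _ measurableT curv_int).
  rewrite Rintegral_sum//.
  rewrite (expect_draw hD k (fun S => fine (curvature f X S))) -/C.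
  (* By independence each expected block gap is multiplied by the probability [alpha] that its block
     is drawn. *)
  rewrite (eq_bigr (fun n => alpha * \int[P]_w b n w)) => [|n _]; last first.
    rewrite (expect_indep hD (fun S => (n \in S)%:R) (b_ad n)) draw_mem_prob//.
    by rewrite -halpha mulrC.
  rewrite -mulr_sumr lerD2r lerD2l lerN2 mulrA [ga * _]mulrC.
  by rewrite ler_wpM2l// mulr_ge0 ?(ltW a_gt0)// (ltW (step_size_gt0 _ _)).
have e0 : e 0%N = f x0 - f xstar.
  rewrite /e /h; under eq_Rintegral do rewrite x_init.
  exact: Rintegral_probability_cst.
rewrite (expected_curvatureE _ Cfin) -/C; split.
  rewrite (expectationE_Rintegral (x_int t h)) -EFinM -EFinD lee_fin -e0.
  exact: descent_rate_explicit.
have [k gk] := descent_gap a_gt0 a_le1 e_ge0 e_le_g C_ge0 descent ht.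
apply: (bigmin_inf k) => //.
rewrite (expectationE_Rintegral (x_int k (duality_gap f X))).
by rewrite -[(_ * C%:E)%E]EFinM -EFinD -EFinM lee_fin -e0.
Qed.
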